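(* Let $D$ be a Dedekind domain which is countable and all of whose nonzero ideals have finite index, let $n\ge1$, and let $(d^+,d^-)$ be a density on $D^n$, extended to subsets of $\hat D^n$ by $d^\pm(Z):=d^\pm(Z\cap D^n)$. Let $\mathcal T$ be a subset of $\mathcal S(D)$ having the zero ideal $0$ as an accumulation point, and let $X\subseteq D^n$. Assume that for every $\sigma\in\mathcal T$ the set $X_\sigma$ has a density and $d(X_\sigma)=\mu(X_\sigma)$. Then $$\lim_{\sigma\to0,\ \sigma\in\mathcal T}d^+(X_\sigma-X)=0$$ holds if and only if $X$ has a density and $d(X)=\mu(\hat X)$.
   Context: $\hat D=\varprojlim_{\mathfrak a}D/\mathfrak a$ (inverse limit over nonzero ideals, each quotient discrete) is a compact topological ring containing $D$ densely; $\hat D^n$ has the product topology, $\hat X$ denotes closure in $\hat D^n$, and $\mu$ is the Haar measure on $\hat D^n$ with $\mu(\hat D^n)=1$. $\mathcal S(D)$ is the set of closed ideals of $\hat D$ (every such ideal is principal), topologized as a quotient of $\hat D$ via the surjection $\rho:\hat D\to\mathcal S(D)$, $x\mapsto x\hat D$; $0$ denotes the zero ideal. For $\sigma\in\mathcal S(D)$ let $\hat\pi_\sigma:\hat D^n\to(\hat D/\sigma)^n$ be the projection, $(\hat D/\sigma)^n$ having the quotient topology, and for $Z\subseteq\hat D^n$ put $Z_\sigma:=\hat\pi_\sigma^{-1}\big(\overline{\hat\pi_\sigma(Z)}\big)$. For a nonzero ideal $\mathfrak a$ of $D$ put $\|\mathfrak a\|=|D/\mathfrak a|$. A density on $D^n$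 is a pair of functions $d^+,d^-:2^{D^n}\to[0,1]$ such that for all $X,Y\subseteq D^n$: (1) $d^-(D^n)=1$; (2) $d^-(X)\le d^+(X)$; (3) $X\subseteq Y$ implies $d^+(X)\le d^+(Y)$ and $d^-(X)\le d^-(Y)$; (4) if $D^n$ is the disjoint union of $X$ and $Y$ then $d^+(X)+d^-(Y)=1$; (5) if $X\cap Y=\emptyset$ then $d^+(X\cup Y)\le d^+(X)+d^+(Y)$ and $d^-(X\cup Y)\ge d^-(X)+d^-(Y)$; (6) $d^\pm(\{x+b\mid x\in X\})=d^\pm(X)$ for every $b\in D^n$; (7) for every nonzero ideal $\mathfrak a$, $d^+(\mathfrak aD^n)=d^-(\mathfrak aD^n)=\|\mathfrak a\|^{-n}$. A set $Z$ has a density if $d^+(Z)=d^-(Z)$, the common value being $d(Z)$. *)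

(* Defs.v *)
From HB Require Import structures.
From mathcomp Require Import all_boot all_order all_algebra.
From mathcomp Require Import generic_quotient fraction mxpoly finmap.
From mathcomp Require Import all_classical all_reals all_analysis.

Set Implicit Arguments.
Unset Strict Implicit.
Unset Printing Implicit Defensive.

Import Order.TTheory GRing.Theory Num.Theory.
Import numFieldNormedType.Exports.

Local Open Scope classical_set_scope.
Local Open Scope ring_scope.
Local Open Scope quotient_scope.

Identity Coercion fun_of_set : set >-> Funclass.

(* The ideals of [ring_quotient] are proper by definition; here the unit ideal
   must be allowed, whence also [comPzRingType]. *)
Record ideal (R : comPzRingType) := Ideal {
  ideal_set :> set R;
  ideal0 : ideal_set 0;
  idealD : forall x y, ideal_set x -> ideal_set y -> ideal_set (x + y);
  idealM : forall r x, ideal_set x -> ideal_set (r * x) }.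

Section QuotientRing.
Variables (R : comPzRingType) (I : ideal R).

Lemma idealN x : I x -> I (- x).
Proof. by move=> Ix; rewrite -mulN1r; exact: idealM. Qed.

Lemma idealB x y : I x -> I y -> I (x - y).
Proof. by move=> Ix Iy; apply: idealD => //; exact: idealN. Qed.

Definition ideal_equiv (x y : R) : bool := `[< I (x - y) >].

Lemma ideal_equiv_is_equiv : equiv_class_of ideal_equiv.
Proof.
split=> [x|x y|y x z]; rewrite /ideal_equiv.
- by apply/asboolP; rewrite subrr; exact: ideal0.
- by apply/asbool_equiv_eq; split=> /idealN; rewrite opprB.
- move=> /asboolP xy /asboolP yz; apply/asboolP.
  by rewrite -(subrKA y); exact: idealD.
Qed.

Canonical ideal_equiv_equiv := EquivRelPack ideal_equiv_is_equiv.
Canonical ideal_equiv_encModRel := defaultEncModRel ideal_equiv.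

Definition quot : Type := {eq_quot ideal_equiv}.

HB.instance Definition _ : EqQuotient R ideal_equiv quot := EqQuotient.on quot.
HB.instance Definition _ := Choice.on quot.

Lemma quot_eqP x y : (\pi_quot x = \pi_quot y) <-> I (x - y).
Proof.
split=> [/eqmodP/asboolP //|h]; exact/eqmodP/asboolP.
Qed.

Lemma quot_reprP x : I (x - repr (\pi_quot x)).
Proof. by apply/quot_eqP; rewrite reprK. Qed.

Definition quot_add : quot -> quot -> quot := lift_op2 quot +%R.
Definition quot_opp : quot -> quot := lift_op1 quot -%R.
Definition quot_mul : quot -> quot -> quot := lift_op2 quot *%R.

Lemma pi_quot_add x y : \pi_quot (x + y) = quot_add (\pi_quot x) (\pi_quot y).
Proof.
unlock quot_add; apply/quot_eqP; rewrite opprD addrACA.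
by apply: idealD; exact: quot_reprP.
Qed.

Lemma pi_quot_opp x : \pi_quot (- x) = quot_opp (\pi_quot x).
Proof. by unlock quot_opp; apply/quot_eqP; rewrite -opprD; apply: idealN; exact: quot_reprP. Qed.

Lemma pi_quot_mul x y : \pi_quot (x * y) = quot_mul (\pi_quot x) (\pi_quot y).
Proof.
unlock quot_mul; apply/quot_eqP; set x' := repr _; set y' := repr _.
rewrite -(subrKA (x * y')) -mulrBr -mulrBl; apply: idealD.
  by apply: idealM; exact: quot_reprP.
by rewrite mulrC; apply: idealM; exact: quot_reprP.
Qed.

Lemma quot_addA : associative quot_add.
Proof.
by move=> x y z; rewrite -[x]reprK -[y]reprK -[z]reprK -!pi_quot_add addrA.
Qed.

Lemma quot_addC : commutative quot_add.
Proof. by move=> x y; rewrite -[x]reprK -[y]reprK -!pi_quot_add addrC. Qed.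

Lemma quot_add0 : left_id (\pi_quot 0) quot_add.
Proof. by move=> x; rewrite -[x]reprK -!pi_quot_add add0r. Qed.

Lemma quot_addN : left_inverse (\pi_quot 0) quot_opp quot_add.
Proof. by move=> x; rewrite -[x]reprK -pi_quot_opp -pi_quot_add addNr. Qed.

HB.instance Definition _ :=
  GRing.isZmodule.Build quot quot_addA quot_addC quot_add0 quot_addN.

Lemma quot_mulA : associative quot_mul.
Proof.
by move=> x y z; rewrite -[x]reprK -[y]reprK -[z]reprK -!pi_quot_mul mulrA.
Qed.

Lemma quot_mulC : commutative quot_mul.
Proof. by move=> x y; rewrite -[x]reprK -[y]reprK -!pi_quot_mul mulrC. Qed.

Lemma quot_mul1 : left_id (\pi_quot 1) quot_mul.
Proof. by move=> x; rewrite -[x]reprK -!pi_quot_mul mul1r. Qed.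

Lemma quot_mulDl : left_distributive quot_mul quot_add.
Proof.
move=> x y z; rewrite -[x]reprK -[y]reprK -[z]reprK.
by rewrite -!(pi_quot_mul, pi_quot_add) mulrDl.
Qed.

HB.instance Definition _ := GRing.Zmodule_isComPzRing.Build quot
  quot_mulA quot_mulC quot_mul1 quot_mulDl.

Lemma piquotD x y : \pi_quot (x + y) = \pi_quot x + \pi_quot y.
Proof. exact: pi_quot_add. Qed.

Lemma piquotN x : \pi_quot (- x) = - \pi_quot x.
Proof. exact: pi_quot_opp. Qed.

Lemma piquotM x y : \pi_quot (x * y) = \pi_quot x * \pi_quot y.
Proof. exact: pi_quot_mul. Qed.

End QuotientRing.

Section Dedekind.
Variable D : idomainType.

Definition nonzero_ideal (I : ideal D) := exists2 x, I x & x != 0.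

Definition prime_ideal (I : ideal D) :=
  ~ I 1 /\ forall x y, I (x * y) -> I x \/ I y.

Definition maximal_ideal (I : ideal D) :=
  ~ I 1 /\ forall J : ideal D, I `<=` J -> J 1 \/ J `<=` I.

Definition noetherian := forall I : ideal D,
  exists (m : nat) (g : 'I_m -> D),
    I = [set x | exists c : 'I_m -> D, x = \sum_i c i * g i] :> set D.

Definition integrally_closed := forall u : {fraction D},
  integralOver (@tofrac D) u -> exists x : D, u = tofrac x.

(* Fields are not excluded: for them the completion below is the zero ring. *)
Definition dedekind_domain := [/\ noetherian, integrally_closed &
  forall I : ideal D, nonzero_ideal I -> prime_ideal I -> maximal_ideal I].

Record nzideal := NzIdeal {
  nzideal_val :> ideal D;
  nzidealP : nonzero_ideal nzideal_val }.

HB.instance Definition _ := gen_eqMixin nzideal.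
HB.instance Definition _ := gen_choiceMixin nzideal.

Definition finite_quotients := forall a : nzideal, finite_set [set: quot a].

Definition ideal_norm (a : nzideal) : nat := #|` fset_set [set: quot a]|.

(* The canonical projection D/a -> D/b; only meaningful when a `<=` b. *)
Definition quot_proj (a b : nzideal) (u : quot a) : quot b := \pi_(quot b) (repr u).

Definition dquot (a : nzideal) : topologicalType := discrete_topology (quot a).

Definition compatible : set (prod_topology dquot) :=
  [set x | forall a b : nzideal, a `<=` b -> quot_proj b (x a : quot a) = x b].

(* The inverse limit of the discrete rings D/a, with the topology induced by the
   product; the ring operations are componentwise. *)
Definition completion : Type := set_type compatible.

HB.instance Definition _ := Topological.on completion.

Definition comp_coord (x : completion) (a : nzideal) : quot a := val x a.

Lemma quot_projE (a b : nzideal) x : a `<=` b ->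
  quot_proj b (\pi_(quot a) x) = \pi_(quot b) x.
Proof.
move=> ab; apply/quot_eqP; rewrite -opprB; apply: idealN; apply: ab.
exact: quot_reprP.
Qed.

Lemma comp_coordP (x : completion) (a b : nzideal) : a `<=` b ->
  quot_proj b (comp_coord x a) = comp_coord x b.
Proof. by move=> ab; have := set_mem (valP x); apply. Qed.

Lemma completion_ext (x y : completion) :
  (forall a, comp_coord x a = comp_coord y a) -> x = y.
Proof. by move=> xy; apply: val_inj; apply: functional_extensionality_dep. Qed.

Definition comp_mk (x : forall a : nzideal, quot a)
    (xP : forall a b : nzideal, a `<=` b -> quot_proj b (x a) = x b) :
    completion :=
  exist _ (x : prod_topology dquot) (mem_set (xP : compatible x)).

Definition to_completion (x : D) : completion :=
  comp_mk (fun a b => @quot_projE a b x).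

Lemma comp_add_subproof (x y : completion) (a b : nzideal) : a `<=` b ->
  quot_proj b (comp_coord x a + comp_coord y a) = comp_coord x b + comp_coord y b.
Proof.
move=> ab; rewrite -(comp_coordP x ab) -(comp_coordP y ab).
rewrite -[comp_coord x a]reprK -[comp_coord y a]reprK -piquotD.
by rewrite !quot_projE// piquotD.
Qed.

Lemma comp_opp_subproof (x : completion) (a b : nzideal) : a `<=` b ->
  quot_proj b (- comp_coord x a) = - comp_coord x b.
Proof.
move=> ab; rewrite -(comp_coordP x ab).
by rewrite -[comp_coord x a]reprK -piquotN !quot_projE// piquotN.
Qed.

Lemma comp_mul_subproof (x y : completion) (a b : nzideal) : a `<=` b ->
  quot_proj b (comp_coord x a * comp_coord y a) = comp_coord x b * comp_coord y b.
Proof.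
move=> ab; rewrite -(comp_coordP x ab) -(comp_coordP y ab).
rewrite -[comp_coord x a]reprK -[comp_coord y a]reprK -piquotM.
by rewrite !quot_projE// piquotM.
Qed.

Definition comp_add x y := comp_mk (comp_add_subproof x y).
Definition comp_opp x := comp_mk (comp_opp_subproof x).
Definition comp_mul x y := comp_mk (comp_mul_subproof x y).

Lemma comp_addA : associative comp_add.
Proof. by move=> x y z; apply: completion_ext => a; exact: addrA. Qed.

Lemma comp_addC : commutative comp_add.
Proof. by move=> x y; apply: completion_ext => a; exact: addrC. Qed.

Lemma comp_add0 : left_id (to_completion 0) comp_add.
Proof. by move=> x; apply: completion_ext => a; exact: add0r. Qed.

Lemma comp_addN : left_inverse (to_completion 0) comp_opp comp_add.
Proof. by move=> x; apply: completion_ext => a; exact: addNr. Qed.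

HB.instance Definition _ :=
  GRing.isZmodule.Build completion comp_addA comp_addC comp_add0 comp_addN.

Lemma comp_mulA : associative comp_mul.
Proof. by move=> x y z; apply: completion_ext => a; exact: mulrA. Qed.

Lemma comp_mulC : commutative comp_mul.
Proof. by move=> x y; apply: completion_ext => a; exact: mulrC. Qed.

Lemma comp_mul1 : left_id (to_completion 1) comp_mul.
Proof. by move=> x; apply: completion_ext => a; exact: mul1r. Qed.

Lemma comp_mulDl : left_distributive comp_mul comp_add.
Proof. by move=> x y z; apply: completion_ext => a; exact: mulrDl. Qed.

HB.instance Definition _ := GRing.Zmodule_isComPzRing.Build completion
  comp_mulA comp_mulC comp_mul1 comp_mulDl.

HB.instance Definition _ := isPointed.Build completion 0.

Lemma comp_coordM (x y : completion) a :
  comp_coord (x * y) a = comp_coord x a * comp_coord y a.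
Proof. by []. Qed.

Lemma proj_nbhs (x : prod_topology dquot) (a : nzideal) :
  nbhs x [set y | y a = x a].
Proof.
apply: (@proj_continuous _ dquot a x [set u | u = x a]).
exact: (@discrete_set1 (discrete_topology (quot a))).
Qed.

Lemma closed_compatible : closed compatible.
Proof.
move=> x clx a b ab.
have [y [yP [/= <- <-]]] := clx _ (filterI (proj_nbhs x a) (proj_nbhs x b)).
exact: yP.
Qed.

Lemma compact_completion : finite_quotients -> compact [set: completion].
Proof.
move=> fin F FF _.
pose v (x : completion) : prod_topology dquot := val x.
have cK : compact compatible.
  have /subclosed_compact : compact [set: prod_topology dquot].
    have -> : [set: prod_topology dquot] = [set x | forall a, setT (x a)].
      by apply/seteqP; split.
    apply: (@tychonoff nzideal dquot (fun=> setT)) => a.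
    exact/finite_compact/fin.
  by apply; [exact: closed_compatible | exact: subsetT].
have FK : F (v @^-1` compatible).
  by apply: filterE => x; have /set_mem := valP x.
have [p [Kp clp]] := cK _ (fmap_proper_filter v FF) FK.
exists (exist _ p (mem_set Kp)); split => // A B FA [_ [[W oW <-] Wp WB]].
have FA' : F (v @^-1` (v @` A)) by apply: filterS FA => x Ax; exists x.
have [_ [[x Ax <-] Wx]] := clp _ W FA' (open_nbhs_nbhs (conj oW Wp)).
by exists x; split => //; exact: WB.
Qed.

Lemma coord_nbhs (x : completion) a :
  nbhs x [set y | comp_coord y a = comp_coord x a].
Proof. exact: (initial_continuous (proj_nbhs (val x) a)). Qed.

Lemma hausdorff_completion : hausdorff_space completion.
Proof.
move=> x y xy; apply: completion_ext => a.
by have [z [/= <- <-]] := xy _ _ (coord_nbhs x a) (coord_nbhs y a).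
Qed.

Lemma continuous_completion (f : completion -> completion) :
  (forall x a, \forall y \near x, comp_coord (f y) a = comp_coord (f x) a) ->
  continuous f.
Proof.
move=> fP; apply: continuous_comp_initial => x.
have FF : Filter ((set_val \o f : completion -> prod_topology dquot) @ x).
  exact: (@fmap_filter _ _ _ (nbhs x) (nbhs_filter x)).
apply/cvg_sup => a U.
move=> [_ [[W oW <-] Wx WU]].
apply: filterS (fP x a) => y /= fyx; apply: WU => /=.
have : W (comp_coord (f x) a) := Wx.
by rewrite -fyx.
Qed.

Definition principal_set (x : completion) : set completion :=
  range (fun z => x * z).

Lemma closed_principal (x : completion) :
  finite_quotients -> closed (principal_set x).
Proof.
move=> fin; apply: compact_closed; first exact: hausdorff_completion.
apply: continuous_compact (compact_completion fin).
apply: continuous_subspaceT; apply: continuous_completion => y a.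
by apply: filterS (coord_nbhs y a) => z /= zy; rewrite !comp_coordM zy.
Qed.

Definition principal_ideal (x : completion) : ideal completion.
Proof.
refine (@Ideal _ (principal_set x) _ _ _).
- by exists 0; rewrite // mulr0.
- by move=> _ _ [y _ <-] [z _ <-]; exists (y + z); rewrite // mulrDr.
- by move=> r _ [y _ <-]; exists (r * y); rewrite // mulrCA.
Defined.

Record closed_ideal := ClosedIdeal {
  closed_ideal_val :> ideal completion;
  closed_idealP : closed closed_ideal_val }.

(* The set S(D); the finiteness hypothesis is needed for [rho] below to take
   closed values, hence for the quotient topology. *)
Definition closed_ideals (fin : finite_quotients) : Type := closed_ideal.

Section ClosedIdeals.
Variable fin : finite_quotients.

Definition rho (x : completion) : closed_ideals fin :=
  @ClosedIdeal (principal_ideal x) (@closed_principal x fin).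

HB.instance Definition _ := gen_eqMixin (closed_ideals fin).
HB.instance Definition _ := gen_choiceMixin (closed_ideals fin).

Definition open_closed_ideals (U : set (closed_ideals fin)) :=
  open (rho @^-1` U).

Lemma open_closed_idealsT : open_closed_ideals setT.
Proof. by rewrite /open_closed_ideals preimage_setT; exact: openT. Qed.

Lemma open_closed_idealsI : setI_closed open_closed_ideals.
Proof. by move=> U V oU oV; exact: openI. Qed.

Lemma open_closed_ideals_bigU (I : Type) (f : I -> set (closed_ideals fin)) :
  (forall i, open_closed_ideals (f i)) -> open_closed_ideals (\bigcup_i f i).
Proof. by move=> of_; apply: bigcup_open => i _; exact: of_. Qed.

HB.instance Definition _ := isOpenTopological.Build (closed_ideals fin)
  open_closed_idealsT open_closed_idealsI open_closed_ideals_bigU.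

Definition zero_ideal : ideal completion.
Proof.
refine (@Ideal _ [set 0] _ _ _) => //.
- by move=> _ _ -> ->; rewrite /= addr0.
- by move=> r _ ->; rewrite /= mulr0.
Defined.

Lemma closed_zero : closed zero_ideal.
Proof. exact/accessible_closed_set1/hausdorff_accessible/hausdorff_completion. Qed.

Definition zero_closed_ideal : closed_ideals fin :=
  @ClosedIdeal zero_ideal closed_zero.

End ClosedIdeals.

Section Vectors.
Variable n : nat.

Definition to_completion_vec (v : 'rV[D]_n) : 'rV[completion]_n :=
  map_mx to_completion v.

Definition quot_vec (s : ideal completion) : Type := 'rV[quot s]_n.

Definition quot_vec_repr (s : ideal completion) (u : quot_vec s) :
  'rV[completion]_n := map_mx repr u.

Definition quot_vec_pi (s : ideal completion) (v : 'rV[completion]_n) :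
  quot_vec s := map_mx \pi_(quot s) v.

Lemma quot_vec_reprK s : cancel (@quot_vec_repr s) (@quot_vec_pi s).
Proof. by move=> u; apply/rowP => i; rewrite !mxE reprK. Qed.

HB.instance Definition _ (s : ideal completion) :=
  isQuotient.Build 'rV[completion]_n (quot_vec s) (@quot_vec_reprK s).

(* Z_s = pi_s^-1 (closure (pi_s Z)) *)
Definition ideal_closure (s : ideal completion) (Z : set 'rV[completion]_n) :
    set 'rV[completion]_n :=
  let pi_s : 'rV[completion]_n -> quotient_topology (quot_vec s) :=
    @quot_vec_pi s in
  pi_s @^-1` closure (pi_s @` Z).

Definition ideal_vec (a : nzideal) : set 'rV[D]_n :=
  [set v | exists (m : nat) (c : 'I_m -> D) (w : 'I_m -> 'rV[D]_n),
     (forall k, a (c k)) /\ v = \sum_k c k *: w k].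

Record is_density (R : realType) (dp dm : set 'rV[D]_n -> R) : Prop := {
  density_rangep : forall X, 0 <= dp X <= 1;
  density_rangem : forall X, 0 <= dm X <= 1;
  densityT : dm setT = 1;
  density_le : forall X, dm X <= dp X;
  density_subp : forall X Y, X `<=` Y -> dp X <= dp Y;
  density_subm : forall X Y, X `<=` Y -> dm X <= dm Y;
  densityC : forall X Y, X `&` Y = set0 -> X `|` Y = setT -> dp X + dm Y = 1;
  densityUp : forall X Y, X `&` Y = set0 -> dp (X `|` Y) <= dp X + dp Y;
  densityUm : forall X Y, X `&` Y = set0 -> dm X + dm Y <= dm (X `|` Y);
  density_transp : forall X b, dp [set x + b | x in X] = dp X;
  density_transm : forall X b, dm [set x + b | x in X] = dm X;
  density_idealp : forall a : nzideal,
    dp (ideal_vec a) = ((ideal_norm a)%:R ^+ n)^-1;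
  density_idealm : forall a : nzideal,
    dm (ideal_vec a) = ((ideal_norm a)%:R ^+ n)^-1 }.

(* The extension d(Z) := d(Z `&` D^n) to subsets Z of the completion. *)
Definition density_ext (R : realType) (d : set 'rV[D]_n -> R)
    (Z : set 'rV[completion]_n) : R := d (to_completion_vec @^-1` Z).

Definition borel_completion :=
  g_sigma_algebraType (@open 'rV[completion]_n).

(* Haar probability measures; the completion being compact and metrizable (D is
   countable), regularity of Borel probability measures is automatic. *)
Definition is_haar (R : realType) (mu : probability borel_completion R) :=
  forall (b : 'rV[completion]_n) (A : set 'rV[completion]_n),
    measurable (A : set borel_completion) ->
    mu [set x + b | x in A] = mu A.

End Vectors.

End Dedekind.

Arguments zero_closed_ideal {D} fin.
Arguments rho {D} fin.
Arguments to_completion {D}.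
Arguments to_completion_vec {D n}.
Arguments is_density {D n R}.
Arguments is_haar {D n R}.

(* Main.v *)
(* Let Z be the image of X in the completion. Once sigma is contained in the
   closure of a nonzero ideal a, the set X_sigma lies between the closure of Z
   and the clopen set Z + (closure of a)^n. As D is countable, the nonzero ideals
   have a countable cofinal decreasing chain, along which these clopen sets
   decrease to the closure of Z; continuity of mu from above then gives
   mu(X_sigma) -> mu(closure Z) as sigma -> 0. Both implications follow from
   dm(X_sigma) - dp(X_sigma - X) <= dm(X) and
   dp(X_sigma - X) <= dp(X_sigma) - dm(X). *)
Require Import Defs.
From HB Require Import structures.
From mathcomp Require Import all_boot all_order all_algebra lra.
From mathcomp Require Import all_classical all_reals all_analysis.

Set Implicit Arguments.
Unset Strict Implicit.
Unset Printing Implicit Defensive.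

Import Order.TTheory GRing.Theory Num.Theory.
Import numFieldNormedType.Exports.

Local Open Scope classical_set_scope.
Local Open Scope ring_scope.


(** * Nonzero ideals of [D]: common lower bounds and a cofinal chain *)

Section NonzeroIdeals.
Variable D : idomainType.
Implicit Types (a b : nzideal D).

Definition principal_int_ideal (x : D) : ideal D.
Proof.
refine (@Ideal D [set y | exists z, y = x * z] _ _ _).
- by exists 0; rewrite mulr0.
- by move=> _ _ [y ->] [z ->]; exists (y + z); rewrite mulrDr.
- by move=> r _ [y ->]; exists (r * y); rewrite mulrCA.
Defined.

Definition principal_nzideal (x : D) (x0 : x != 0) : nzideal D.
Proof.
refine (@NzIdeal D (principal_int_ideal x) _).
by exists x => //; exists 1; rewrite mulr1.
Defined.

Lemma principal_nzideal_sub (x : D) (x0 : x != 0) a :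
  a x -> principal_nzideal x0 `<=` a.
Proof. by move=> ax _ [z ->]; rewrite mulrC; exact: idealM. Qed.

(** The product of nonzero elements of the two ideals is nonzero, as [D] is a domain, and generates
    such a [c]. This makes congruence classes a filter base. *)
Lemma nzidealI_ex a b : exists c : nzideal D, c `<=` a /\ c `<=` b.
Proof.
have [x ax x0] := nzidealP a; have [y b_y y0] := nzidealP b.
have xy0 : x * y != 0 by rewrite mulf_neq0.
exists (principal_nzideal xy0); split; apply: principal_nzideal_sub.
  by rewrite mulrC; exact: idealM.
exact: idealM.
Qed.

(** The ideals are generated by the partial products of an enumeration of the nonzero elements: any
    nonzero [x] in [b] eventually divides these products. *)
Lemma nzideal_chain : countable [set: D] ->
  exists a : nat -> nzideal D,
    (forall m k, (m <= k)%N -> a k `<=` a m) /\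
    (forall b, exists k, a k `<=` b).
Proof.
move=> /countable_injP[f finj].
(* The default 1 for codes [k] that no nonzero element has keeps all partial products nonzero. *)
pose e k : D := xget 1 [set x | x != 0 /\ f x = k].
have e0 k : e k != 0.
  by rewrite /e; case: xgetP => [x _ [] //|_]; exact: oner_neq0.
have eP x : x != 0 -> e (f x) = x.
  move=> x0; rewrite /e; case: xgetP => [y _ [_ fyx]|/(_ x)]; last by case.
  by apply: finj fyx; rewrite inE.
have p0 k : \prod_(i < k) e i != 0 by apply/prodf_neq0 => i _; exact: e0.
exists (fun k => principal_nzideal (p0 k)); split.
  move=> m k mk; apply: principal_nzideal_sub.
  exists (\prod_(m <= i < k) e i).
  by rewrite -2!(big_mkord xpredT e) -big_cat_nat.
move=> b; have [x bx x0] := nzidealP b.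
(* The product over [i < k] has [x] as a factor only once [k] exceeds [f x]. *)
exists (f x).+1; apply: principal_nzideal_sub.
by rewrite big_ord_recr /= eP//; exact: idealM.
Qed.

End NonzeroIdeals.

(** * Congruence neighbourhoods, thickenings and the closures modulo an ideal *)

Section Completion.
Variables (D : idomainType) (n : nat).
Implicit Types (a b : nzideal D) (v w : 'rV[completion D]_n).
Implicit Types (Z : set 'rV[completion D]_n).

Lemma comp_coordS (x y : completion D) a b : a `<=` b ->
  comp_coord x a = comp_coord y a -> comp_coord x b = comp_coord y b.
Proof. by move=> ab xy; rewrite -!(comp_coordP _ ab) xy. Qed.

(** A basic neighbourhood in the product restricts finitely many coordinates; a common smaller ideal
    controls them all at once. *)
Lemma nbhs_completion_coord (x : completion D) (V : set (completion D)) :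
  nbhs x V -> exists a, [set y | comp_coord y a = comp_coord x a] `<=` V.
Proof.
pose F : set_system (completion D) :=
  filter_from [set: nzideal D]
    (fun a => [set y | comp_coord y a = comp_coord x a]).
have one0 : (1 : D) != 0 by exact: oner_neq0.
have FF : Filter F.
  apply: filter_from_filter; first by exists (principal_nzideal one0).
  move=> a b _ _; have [c [ca cb]] := nzidealI_ex a b.
  by exists c => // y /= yx; split; [exact: comp_coordS yx|exact: comp_coordS yx].
pose w : completion D -> prod_topology (@dquot D) := set_val.
(* Convergence in the product is tested coordinatewise, and the coordinate at [a] is constant on the
   base set of index [a]. *)
have Fx : w @ F --> w x.
  apply/cvg_sup => a U [_ [[W oW <-] Wx WU]].
  exists a => // y /= yx; apply: WU => /=.
  have : W (comp_coord x a) := Wx.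
  by rewrite -yx.
move=> [_ [[W oW <-] Wx WV]].
have [a _ aW] := Fx _ (open_nbhs_nbhs (conj oW Wx)).
by exists a => y /aW; exact: WV.
Qed.

Definition vec_coord a v : 'rV[quot a]_n := map_mx (fun x => comp_coord x a) v.

Lemma vec_coordP a v w :
  vec_coord a v = vec_coord a w <->
  forall i j, comp_coord (v i j) a = comp_coord (w i j) a.
Proof.
split=> [/matrixP vw i j|vw]; first by have := vw i j; rewrite !mxE.
by apply/matrixP => i j; rewrite !mxE.
Qed.

Lemma vec_coordS a b v w : a `<=` b ->
  vec_coord a v = vec_coord a w -> vec_coord b v = vec_coord b w.
Proof.
move=> ab /vec_coordP vw; apply/vec_coordP => i j.
exact: comp_coordS (vw i j).
Qed.

Lemma vec_coord_nbhs v a : nbhs v [set w | vec_coord a w = vec_coord a v].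
Proof.
exists (fun i j => [set y | comp_coord y a = comp_coord (v i j) a]).
  by move=> i j; exact: coord_nbhs.
by move=> w /= wv; exact/vec_coordP.
Qed.

Lemma nbhs_vec_coord v (V : set 'rV[completion D]_n) :
  nbhs v V -> exists a, [set w | vec_coord a w = vec_coord a v] `<=` V.
Proof.
pose F : set_system 'rV[completion D]_n :=
  filter_from [set: nzideal D]
    (fun a => [set w | vec_coord a w = vec_coord a v]).
have one0 : (1 : D) != 0 by exact: oner_neq0.
have FF : Filter F.
  apply: filter_from_filter; first by exists (principal_nzideal one0).
  move=> a b _ _; have [c [ca cb]] := nzidealI_ex a b.
  by exists c => // y /= yx; split; [exact: vec_coordS yx|exact: vec_coordS yx].
move=> [P vP PV].
have FP i j : F [set w | P i j (w i j)].
  have [a aP] := nbhs_completion_coord (vP i j).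
  by exists a => // w /= /vec_coordP wv; exact: aP.
have [a _ aP] := filter_forall _ (fun i => filter_forall _ (FP i)).
by exists a => w /aP; exact: PV.
Qed.

(* This is Z + (closure of a)^n, which is both open and closed. *)
Definition thickening a Z := vec_coord a @^-1` (vec_coord a @` Z).

Lemma open_vec_coord_preimage a (B : set 'rV[quot a]_n) :
  open (vec_coord a @^-1` B).
Proof.
rewrite openE => v Bv; apply: filterS (vec_coord_nbhs v a) => w /= wv.
by rewrite /= wv.
Qed.

Lemma closed_thickening a Z : closed (thickening a Z).
Proof. by rewrite -openC /thickening preimage_setC; exact: open_vec_coord_preimage. Qed.

Lemma sub_thickening a Z : Z `<=` thickening a Z.
Proof. by move=> v Zv; exists v. Qed.

Lemma thickeningS a b Z : a `<=` b -> thickening a Z `<=` thickening b Z.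
Proof. by move=> ab v [w Zw wv]; exists w => //; exact: vec_coordS wv. Qed.

(** Thickenings are closed, and every neighbourhood of [v] contains its class modulo some [a k]. The
    countable intersection prepares continuity of the measure from above. *)
Lemma closure_thickening (a : nat -> nzideal D) Z :
  (forall b, exists k, a k `<=` b) ->
  closure Z = \bigcap_k thickening (a k) Z.
Proof.
move=> cofin; apply/seteqP; split=> v.
  move=> clv k _; apply: closed_thickening; apply: closureS clv.
  exact: sub_thickening.
move=> vZ V /nbhs_vec_coord[b bV]; have [k akb] := cofin b.
have [z Zz zv] := vZ k I.
by exists z; split=> //; apply: bV; exact: vec_coordS zv.
Qed.

Lemma pi_quot_vecE (s : ideal (completion D)) :
  \pi_(quotient_topology (quot_vec n s))%qT = @quot_vec_pi D n s.
Proof. by rewrite generic_quotient.pi.unlock. Qed.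

Lemma continuous_quot_vec_pi (s : ideal (completion D)) :
  continuous (@quot_vec_pi D n s :
    'rV[completion D]_n -> quotient_topology (quot_vec n s)).
Proof. by rewrite -pi_quot_vecE; exact: pi_continuous. Qed.

Lemma closed_ideal_closure (s : ideal (completion D)) Z :
  closed (ideal_closure s Z).
Proof.
apply: closed_comp; last exact: closed_closure.
by move=> v _; exact: continuous_quot_vec_pi.
Qed.

Lemma sub_ideal_closure (s : ideal (completion D)) Z : Z `<=` ideal_closure s Z.
Proof. by move=> v Zv; apply: subset_closure; exists v. Qed.

Lemma closure_sub_ideal_closure (s : ideal (completion D)) Z :
  closure Z `<=` ideal_closure s Z.
Proof.
move=> v clv; apply: closed_ideal_closure; apply: closureS clv.
exact: sub_ideal_closure.
Qed.

(** Since [s] vanishes modulo [a], reduction modulo [a] factors through the quotient by [s]. The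
    complement of the thickening is thus saturated, and its image is an open set missing the image
    of [Z]. *)
Lemma ideal_closure_sub_thickening (s : ideal (completion D)) a Z :
  (forall x, s x -> comp_coord x a = comp_coord 0 a) ->
  ideal_closure s Z `<=` thickening a Z.
Proof.
move=> sa v clv; apply: contrapT => vZ.
pose Q := quotient_topology (quot_vec n s).
have reprE w : vec_coord a (quot_vec_repr (quot_vec_pi s w)) = vec_coord a w.
  apply/vec_coordP => i j; rewrite !mxE.
  have /sa := quot_reprP s (w i j).
  rewrite [LHS]/(comp_coord (w i j) a - comp_coord (repr _) a).
  by move=> /eqP; rewrite subr_eq0 => /eqP.
pose O : set Q := [set q : Q | ~ (vec_coord a @` Z)
  (vec_coord a (@quot_vec_repr D n s q))].
have oO : open O.
  rewrite /open /= /quotient_open.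
  (* Openness in the quotient means openness of the preimage, here the complement of a closed
     thickening. *)
  have -> : \pi_(Q)%qT @^-1` O = ~` thickening a Z.
    rewrite pi_quot_vecE.
    by apply/seteqP; split=> w; rewrite /O /thickening /= reprE.
  by rewrite openC; exact: closed_thickening.
have Ov : O (@quot_vec_pi D n s v : Q) by rewrite /O /= reprE.
have [_ [[z Zz <-]]] := clv _ (open_nbhs_nbhs (conj oO Ov)).
by apply; rewrite reprE; exists z.
Qed.

End Completion.

(** * Injectivity of the embedding and neighbourhoods of the zero ideal *)

Section ClosedIdeals.
Variables (D : idomainType) (n : nat).

(* A nonzero completion excludes fields, where injectivity fails: some ideal a
   is proper, and with 0 <> t in a, the ideal ((x - y) t) separates x from y. *)
Lemma to_completion_inj : (exists x : completion D, x != 0) ->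
  injective (to_completion : D -> completion D).
Proof.
move=> [z /eqP z0] x y xy; apply/eqP; rewrite -subr_eq0.
apply: contrapT => /negP xy0.
have [a za] : exists a, comp_coord z a != comp_coord 0 a.
  apply: contrapT => /forallNP za; apply: z0; apply: completion_ext => a.
  by apply/eqP; rewrite -[_ == _]negbK; apply/negP; exact: za.
have a1 : ~ a 1.
  move=> a1; move/eqP: za; apply.
  rewrite -[comp_coord z a]reprK -[comp_coord 0 a]reprK; apply/quot_eqP.
  by rewrite -[_ - _]mulr1; exact: idealM.
have [t a_t t0] := nzidealP a.
have txy0 : (x - y) * t != 0 by rewrite mulf_neq0.
have /quot_eqP [u] := congr1 (fun v => comp_coord v (principal_nzideal txy0)) xy.
rewrite -mulrA -[LHS]mulr1 => /(mulfI xy0) tu; apply: a1.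
by rewrite tu mulrC; exact: idealM.
Qed.

Lemma to_completion_vec_inj : (exists x : completion D, x != 0) ->
  injective (to_completion_vec : 'rV[D]_n -> 'rV[completion D]_n).
Proof.
move=> /to_completion_inj inj v w /matrixP vw; apply/matrixP => i j.
by apply: inj; have := vw i j; rewrite !mxE.
Qed.

Lemma closed_ideal_ext (s t : closed_ideal D) :
  (s : set (completion D)) = t -> s = t.
Proof.
case: s => [[s s0 sD sM] cs]; case: t => [[t t0 tD tM] ct] /= st.
subst t; rewrite (Prop_irrelevance s0 t0) (Prop_irrelevance sD tD).
by rewrite (Prop_irrelevance sM tM) in cs *; rewrite (Prop_irrelevance cs ct).
Qed.

(** In a trivial completion every closed ideal is zero. Hence an accumulation point at 0 rules out
    the case of a field. *)
Lemma completion_neq0 (fin : finite_quotients D) (s : closed_ideals fin) :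
  s != zero_closed_ideal fin -> exists x : completion D, x != 0.
Proof.
move=> /eqP s0; apply: contrapT => /forallNP triv.
have all0 (x : completion D) : x = 0.
  by apply/eqP; rewrite -[_ == _]negbK; apply/negP; exact: triv.
apply: s0; apply: closed_ideal_ext; apply/seteqP; split=> x.
  by move=> _; exact: all0.
by move=> ->; exact: ideal0.
Qed.

(** Whether all multiples of [x] vanish modulo [a] depends only on the coordinate of [x] at [a], so
    the preimage under [rho] is open. *)
Lemma nbhs_zero_closed_ideal (fin : finite_quotients D) (a : nzideal D) :
  \forall s \near zero_closed_ideal fin,
    forall x, (s : closed_ideal D) x -> comp_coord x a = comp_coord 0 a.
Proof.
apply: open_nbhs_nbhs; split; last by move=> x ->.
rewrite /open /= /open_closed_ideals openE => x /= xa.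
apply: filterS (coord_nbhs x a) => y /= yx _ [z _ <-].
rewrite comp_coordM yx -comp_coordM; apply: xa.
by exists z.
Qed.

End ClosedIdeals.

(** * Convergence of the measures of the closures modulo an ideal *)

Section Measure.
Variables (R : realType) (D : idomainType) (n : nat).
Variables (mu : probability (borel_completion D n) R).
Implicit Types Z : set 'rV[completion D]_n.

Lemma measurable_closed_vec Z :
  closed Z -> measurable (Z : set (borel_completion D n)).
Proof.
move=> cZ; rewrite -[Z]setCK; apply: measurableC.
by apply: sub_sigma_algebra; rewrite openC.
Qed.

Lemma thickening_measure_lt (Z : set 'rV[completion D]_n) (e : R) :
  countable [set: D] -> 0 < e ->
  exists a : nzideal D, (mu (thickening a Z) < mu (closure Z) + e%:E)%E.
Proof.
move=> /nzideal_chain[a [adec acof]] e0.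
have mth k : measurable (thickening (a k) Z : set (borel_completion D n)).
  exact: (measurable_closed_vec (closed_thickening (a := a k) (Z := Z))).
have : mu \o (fun k => thickening (a k) Z) @ \oo --> mu (closure Z).
  rewrite (closure_thickening _ acof); apply: nonincreasing_cvg_mu => //.
  - by rewrite (le_lt_trans (probability_le1 _ _))// ltry.
  - exact: bigcapT_measurable.
  - by move=> m k mk; apply/subsetPset; apply: thickeningS; exact: adec.
have mufin : mu (closure Z) \is a fin_num.
  apply: fin_num_measure.
  exact: (measurable_closed_vec (@closed_closure _ Z)).
have ltm : (mu (closure Z) < mu (closure Z) + e%:E)%E by rewrite lteDl// lte_fin.
move=> /(_ _ (open_ereal_lt' ltm)) [k _ kP].
by exists (a k); exact: (kP k (leqnn k)).
Qed.

Lemma cvg_measure_ideal_closure (fin : finite_quotients D)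
    (Z : set 'rV[completion D]_n) : countable [set: D] ->
  (fun s : closed_ideals fin => fine (mu (ideal_closure s Z)))
    @ zero_closed_ideal fin --> fine (mu (closure Z)).
Proof.
move=> cD.
apply/(@cvgrPdist_lt _ _ _ _ (nbhs_filter (zero_closed_ideal fin))) => e e0.
have [a ae] := thickening_measure_lt Z cD e0.
have := nbhs_zero_closed_ideal fin a.
apply: (@filterS _ _ (nbhs_filter (zero_closed_ideal fin))) => s sa.
have mcl := measurable_closed_vec (@closed_closure _ Z).
have ms := measurable_closed_vec (closed_ideal_closure (s := s) (Z := Z)).
have mth := measurable_closed_vec (closed_thickening (a := a) (Z := Z)).
have h1 : (mu (closure Z) <= mu (ideal_closure s Z))%E.
  by apply: le_measure; rewrite ?inE//; exact: closure_sub_ideal_closure.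
have h2 : (mu (ideal_closure s Z) < mu (closure Z) + e%:E)%E.
  apply: le_lt_trans ae; apply: le_measure; rewrite ?inE//.
  exact: ideal_closure_sub_thickening.
move: h1 h2; rewrite -(fineK (fin_num_measure mu _ mcl)).
rewrite -(fineK (fin_num_measure mu _ ms)) -EFinD lee_fin lte_fin /= => h1 h2.
by rewrite distrC ger0_norm ?subr_ge0// ltrBlDl.
Qed.

End Measure.

(** * Density of a difference of nested sets *)

Section Density.
Variables (R : realType) (D : idomainType) (n : nat).
Variables (dp dm : set 'rV[D]_n -> R) (dens : is_density dp dm).
Implicit Types X Y : set 'rV[D]_n.

Lemma density_setC X : dp (~` X) = 1 - dm X.
Proof. by rewrite -(densityC dens (setICl X) (setUCl X)) addrK. Qed.

(** This is subadditivity of [dp] on complements: [~] X[is the disjoint union of]~[Y] and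
    [Y]\[X]. *)
Lemma density_setD_ge X Y : X `<=` Y -> dm Y - dp (Y `\` X) <= dm X.
Proof.
move=> XY; rewrite -[dm Y](subKr 1) -density_setC -[dm X](subKr 1) -density_setC.
rewrite -addrA -opprD lerD2l lerN2.
have -> : ~` X = ~` Y `|` (Y `\` X).
  apply/seteqP; split=> v /=; last by move=> [nY /XY//|[]].
  by move=> nX; have [Yv|nY] := pselect (Y v); [right|left].
apply: (densityUp dens); apply/seteqP; split=> v //=.
by move=> [nY []].
Qed.

Lemma density_setD_le X Y : X `<=` Y -> dp (Y `\` X) <= dp Y - dm X.
Proof.
move=> XY.
have CE : ~` (Y `\` X) = ~` Y `|` X.
  apply/seteqP; split=> v /=.
    move=> nYX; have [Xv|nX] := pselect (X v); [by right|left=> Yv].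
    by apply: nYX.
  by move=> [nY|Xv] [].
have h1 := densityC dens (setICr (Y `\` X)) (setUCr _).
have h2 := densityC dens (setICr Y) (setUCr _).
have h3 : dm (~` Y) + dm X <= dm (~` (Y `\` X)).
  rewrite CE; apply: (densityUm dens); apply/seteqP; split=> v //=.
  by move=> [nY /XY].
by lra.
Qed.

End Density.

(** * The equivalence, by passing to the limit along [T] *)

Theorem theorem4p36 (R : realType) (D : idomainType)
    (dedD : dedekind_domain D)
    (countD : countable [set: D])
    (finD : finite_quotients D)
    (n : nat) (n_gt0 : (0 < n)%N)
    (dp dm : set 'rV[D]_n -> R)
    (dens : is_density dp dm)
    (mu : probability (borel_completion D n) R)
    (haar_mu : is_haar mu)
    (T : set (closed_ideals finD))
    (accT : limit_point T (zero_closed_ideal finD))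
    (X : set 'rV[D]_n)
    (densX : forall sigma, T sigma ->
       let Xsigma := ideal_closure sigma (to_completion_vec @` X) in
       density_ext dp Xsigma = density_ext dm Xsigma /\
       (density_ext dp Xsigma)%:E = mu Xsigma) :
  ((fun sigma : closed_ideals finD =>
      density_ext dp (ideal_closure sigma (to_completion_vec @` X)
                        `\` to_completion_vec @` X))
     @ within T ((zero_closed_ideal finD)^') --> (0 : R))
  <->
  (dp X = dm X /\ (dp X)%:E = mu (closure (to_completion_vec @` X))).
Proof.
pose Z := to_completion_vec @` X.
pose Y (s : closed_ideals finD) := to_completion_vec @^-1` ideal_closure s Z.
pose F := within T ((zero_closed_ideal finD)^').
have FF : ProperFilter F.
  split; last exact: within_filter.
  move=> F0; have [s [s0 Ts]] := accT _ F0.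
  by move=> /(_ s0 Ts).
have F_T : F T by exact: withinT.
(* Accumulation yields a nonzero closed ideal, so the completion is nontrivial, [D^n] embeds in it,
   and the trace of [Z] on [D^n] is exactly [X]. *)
have [s0 [s0_neq0 _ _]] := accT _ filterT.
have inj := to_completion_vec_inj (completion_neq0 s0_neq0) (n := n).
have ZE : to_completion_vec @^-1` Z = X.
  by apply/seteqP; split=> [v [w Xw /inj <-//]|v Xv]; exists v.
have XY s : X `<=` Y s by move=> v Xv; apply: sub_ideal_closure; exists v.
have extE (s : closed_ideals finD) : density_ext dp (ideal_closure s Z `\` Z) = dp (Y s `\` X).
  by rewrite -[in RHS]ZE.
have mufin : mu (closure Z) \is a fin_num.
  apply: fin_num_measure.
  exact: (measurable_closed_vec (@closed_closure _ Z)).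
(* On [T] these densities equal the measures of the closures, whose convergence restricts to the
   finer filter [F]. *)
have cvgY : (fun s => dp (Y s)) @ F --> fine (mu (closure Z)).
  have : (fun s : closed_ideals finD => fine (mu (ideal_closure s Z))) @ F
      --> fine (mu (closure Z)).
    have h := @cvg_measure_ideal_closure _ _ _ mu finD Z countD.
    move=> V /h.
    by apply: (@filterS _ _ (nbhs_filter (zero_closed_ideal finD))) => s Vs _ _.
  apply: cvg_trans; apply: near_eq_cvg; apply: filterS F_T => s Ts /=.
  by have [_ <-] := densX _ Ts.
rewrite -/F -/Z; under eq_fun do rewrite extE; split=> [lim0|[dpm dmu]].
  (* The two limits give [dp X <= mu(closure Z) <= dm X], and [dm X <= dp X] closes the circle. *)
  have le1 : dp X <= fine (mu (closure Z)).
    apply: cvgr_to_ge cvgY _; apply: nearW => s.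
    exact: (density_subp dens).
  have le2 : fine (mu (closure Z)) <= dm X.
    have lim1 : (fun s => dp (Y s) - dp (Y s `\` X)) @ F
        --> fine (mu (closure Z)).
      by rewrite -[fine _]subr0; apply: cvgB.
    apply: cvgr_to_le lim1 _.
    apply: filterS F_T => s Ts; have [/= dpmY _] := densX _ Ts.
    have := density_setD_ge dens (XY s).
    by rewrite /= [dp (Y s)]dpmY.
  have le3 := density_le dens X.
  have dpE : dp X = fine (mu (closure Z)) by lra.
  by split; [lra|rewrite dpE fineK].
have lim1 : (fun s => dp (Y s) - dp X) @ F --> (0 : R).
  (* The limit 0 is written as [dp X - dp X], and only the first term is turned into the measure of
     the closure. *)
  rewrite -[X in _ --> X](subrr (fine (dp X)%:E)) {1}dmu.
  exact: cvgB cvgY (cvg_cst _).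
apply: squeeze_cvgr (cvg_cst 0) lim1; apply: nearW => s.
rewrite (andP (density_rangep dens _)).1 /= dpm.
exact: density_setD_le.
Qed.
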